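(* The degree $0$ Hochschild cohomology $HH^0(A)$ is isomorphic to $\mathbf{k}$.
   Context: $\mathbf{k}$ is a field of characteristic $0$, $A=\mathbf{k}\langle x,y,z\rangle/(x^2+yx,\,xz,\,zy)$, $A^e=A\otimes A^{\mathrm{op}}$. Hochschild cohomology is placed in non-positive degrees: $HH^{-n}(A)=\mathrm{Ext}^n_{A^e}(A,A)$. *)

(* Defs.v *)
From HB Require Import structures.
From mathcomp Require Import all_boot all_order all_algebra.
From mathcomp Require Import boolp functions finmap.
From mathcomp.multinomials Require Import monalg.

Set Implicit Arguments.
Unset Strict Implicit.
Unset Printing Implicit Defensive.

Import GRing.Theory.
Local Open Scope ring_scope.
Local Open Scope quotient_scope.

(* {malg R[X]} is the free left R-module on X; linear_ext f is the R-linear   *)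
(* map sending the basis vector << x >> to f x.                               *)
Section LinearExtension.
Variables (R : nzRingType) (X : choiceType) (V : lmodType R) (f : X -> V).

Definition linear_ext (u : {malg R[X]}) : V := \sum_(x <- msupp u) u@_x *: f x.

Lemma linear_extEw (d : {fset X}) u : (msupp u `<=` d)%fset ->
  linear_ext u = \sum_(x <- d) u@_x *: f x.
Proof.
move=> le; rewrite /linear_ext (big_fset_incl _ le) // => x _ xNu.
by rewrite mcoeff_outdom // scale0r.
Qed.

Lemma linear_ext_linear : linear linear_ext.
Proof.
move=> c u v; pose d := (msupp u `|` msupp v)%fset.
have ud : (msupp u `<=` d)%fset by apply: fsubsetUl.
have vd : (msupp v `<=` d)%fset by apply: fsubsetUr.
have uvd : (msupp (c *: u + v)%R `<=` d)%fset.
  apply: (fsubset_trans (msuppD_le _ _)); apply: fsetSU.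
  exact: msuppZ_le.
rewrite (linear_extEw ud) (linear_extEw vd) (linear_extEw uvd).
rewrite scaler_sumr -big_split; apply: eq_bigr => x _ /=.
by rewrite mcoeffD mcoeffZ scalerDl scalerA.
Qed.

HB.instance Definition _ :=
  GRing.isLinear.Build R {malg R[X]} V _ linear_ext linear_ext_linear.

Lemma linear_extU c x : linear_ext << c *g x >> = c *: f x.
Proof. by rewrite (linear_extEw msuppU_le) big_seq_fset1 mcoeffUU. Qed.

End LinearExtension.

Lemma malgZU (R : nzRingType) (X : choiceType) (a b : R) (x : X) :
  a *: << b *g x >> = << a * b *g x >>.
Proof. by apply/malgP=> y; rewrite mcoeffZ !mcoeffU mulrnAr. Qed.

Lemma malg_linear_eq (R : nzRingType) (X : choiceType) (V : lmodType R)
    (f g : {linear {malg R[X]} -> V}) :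
  (forall x, f << x >> = g << x >>) -> f =1 g.
Proof.
move=> fg u; rewrite [u]monalgE !raddf_sum; apply: eq_bigr => x _ /=.
by rewrite -[u@_x]mulr1 -malgZU !linearZ fg.
Qed.

Section QuotientModule.
Variables (R : pzRingType) (V : lmodType R) (I : V -> bool).
Hypothesis subI : submod_closed I.

Let zmodI : zmodClosed V := HB.pack I
  (GRing.isZmodClosed.Build V I (GRing.submod_closedB subI)).

Definition lquot : Type := Quotient.quot zmodI.

HB.instance Definition _ := GRing.Zmodule.on lquot.

Definition lclass (u : V) : lquot := \pi_(Quotient.quot zmodI) u.

Lemma lclassP u v : reflect (lclass u = lclass v) (I (u - v)).
Proof.
have -> : I (u - v) = (u - v \in zmodI) by [].
by rewrite Quotient.idealrBE; apply: eqP.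
Qed.

Definition lrepr (q : lquot) : V := repr (q : Quotient.quot zmodI).

Lemma lreprK : cancel lrepr lclass.
Proof. exact: reprK. Qed.

Lemma lreprB u : I (lrepr (lclass u) - u).
Proof. by apply/lclassP; rewrite lreprK. Qed.

Lemma lclassB : {morph lclass : u v / u - v}.
Proof. by move=> u v; rewrite /lclass !piE. Qed.

HB.instance Definition _ :=
  GRing.isZmodMorphism.Build V lquot lclass lclassB.

Definition lquot_scale (c : R) (q : lquot) : lquot := lclass (c *: lrepr q).

Lemma lquot_scaleE c u : lquot_scale c (lclass u) = lclass (c *: u).
Proof.
apply/lclassP; rewrite -scalerBr.
by apply: (GRing.subsemimod_closedZ subI); apply: lreprB.
Qed.

Fact lquot_scaleA a b q :
  lquot_scale a (lquot_scale b q) = lquot_scale (a * b) q.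
Proof. by rewrite -[q]lreprK !lquot_scaleE scalerA. Qed.

Fact lquot_scale1 : left_id 1 lquot_scale.
Proof. by move=> q; rewrite -[q]lreprK lquot_scaleE scale1r. Qed.

Fact lquot_scaleDr : right_distributive lquot_scale +%R.
Proof.
move=> a p q; rewrite -[p]lreprK -[q]lreprK -raddfD !lquot_scaleE -raddfD.
by rewrite scalerDr.
Qed.

Fact lquot_scaleDl q : {morph lquot_scale^~ q : a b / a + b}.
Proof.
by move=> a b; rewrite -[q]lreprK !lquot_scaleE -raddfD scalerDl.
Qed.

HB.instance Definition _ := GRing.Zmodule_isLmodule.Build R lquot
  lquot_scaleA lquot_scale1 lquot_scaleDr lquot_scaleDl.

Fact lclass_scalable : scalable lclass.
Proof. by move=> c u; rewrite -lquot_scaleE. Qed.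

HB.instance Definition _ :=
  GRing.isScalable.Build R V lquot *:%R lclass lclass_scalable.

End QuotientModule.

(* The two-sided ideal generated by S, as the set of finite sums of a g b.    *)
Inductive ideal_gen (F : pzRingType) (S : F -> Prop) : F -> Prop :=
| ideal_gen0 : ideal_gen S 0
| ideal_genM a g b : S g -> ideal_gen S (a * g * b)
| ideal_genD u v : ideal_gen S u -> ideal_gen S v -> ideal_gen S (u + v).

Section QuotientAlgebra.
Variables (k : comNzRingType) (F : algType k) (S : F -> Prop).

Definition ideal_pred : pred F := fun u => `[< ideal_gen S u >].

Lemma ideal_genMl a u : ideal_gen S u -> ideal_gen S (a * u).
Proof.
elim=> [|b g c Sg|v w _ IHv _ IHw].
- by rewrite mulr0; constructor.
- by rewrite !mulrA; constructor.
- by rewrite mulrDr; constructor.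
Qed.

Lemma ideal_genMr a u : ideal_gen S u -> ideal_gen S (u * a).
Proof.
elim=> [|b g c Sg|v w _ IHv _ IHw].
- by rewrite mul0r; constructor.
- by rewrite -mulrA; constructor.
- by rewrite mulrDl; constructor.
Qed.

Fact ideal_pred_submod : submod_closed ideal_pred.
Proof.
split=> [|c u v /asboolP Iu /asboolP Iv]; apply/asboolP; first by constructor.
by constructor=> //; rewrite -mulr_algl; apply: ideal_genMl.
Qed.

Definition alg_quot : Type := lquot ideal_pred_submod.

HB.instance Definition _ := GRing.Lmodule.on alg_quot.

Definition aclass (u : F) : alg_quot := lclass ideal_pred_submod u.
Definition arepr (q : alg_quot) : F := lrepr q.

Fact aclass_linear : linear aclass.
Proof. exact: (@linearP _ _ _ _ (lclass ideal_pred_submod)). Qed.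

HB.instance Definition _ :=
  GRing.isLinear.Build k F alg_quot _ aclass aclass_linear.

Lemma areprK : cancel arepr aclass.
Proof. exact: lreprK. Qed.

Lemma aclassP u v : aclass u = aclass v <-> ideal_gen S (u - v).
Proof.
by split=> [/lclassP/asboolP//|Iuv]; apply/lclassP/asboolP.
Qed.

Lemma areprB u : ideal_gen S (arepr (aclass u) - u).
Proof. by apply/aclassP; rewrite areprK. Qed.

Definition alg_quot_mul (p q : alg_quot) : alg_quot :=
  aclass (arepr p * arepr q).

Lemma alg_quot_mulE u v : alg_quot_mul (aclass u) (aclass v) = aclass (u * v).
Proof.
apply/aclassP; set u' := arepr _; set v' := arepr _.
have -> : u' * v' - u * v = (u' - u) * v' + u * (v' - v).
  by rewrite mulrBl mulrBr addrA subrK.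
by constructor; [apply: ideal_genMr|apply: ideal_genMl]; apply: areprB.
Qed.

Fact alg_quot_mulA : associative alg_quot_mul.
Proof.
by move=> p q r; rewrite -[p]areprK -[q]areprK -[r]areprK !alg_quot_mulE mulrA.
Qed.

Fact alg_quot_mul1q : left_id (aclass 1) alg_quot_mul.
Proof. by move=> p; rewrite -[p]areprK alg_quot_mulE mul1r. Qed.

Fact alg_quot_mulq1 : right_id (aclass 1) alg_quot_mul.
Proof. by move=> p; rewrite -[p]areprK alg_quot_mulE mulr1. Qed.

Fact alg_quot_mulDl : left_distributive alg_quot_mul +%R.
Proof.
move=> p q r; rewrite -[p]areprK -[q]areprK -[r]areprK -raddfD !alg_quot_mulE.
by rewrite -raddfD mulrDl.
Qed.

Fact alg_quot_mulDr : right_distributive alg_quot_mul +%R.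
Proof.
move=> p q r; rewrite -[p]areprK -[q]areprK -[r]areprK -raddfD !alg_quot_mulE.
by rewrite -raddfD mulrDr.
Qed.

HB.instance Definition _ := GRing.Zmodule_isPzRing.Build alg_quot
  alg_quot_mulA alg_quot_mul1q alg_quot_mulq1 alg_quot_mulDl alg_quot_mulDr.

Fact aclass_monoid_morphism : monoid_morphism aclass.
Proof. by split=> // u v; rewrite -alg_quot_mulE. Qed.

HB.instance Definition _ :=
  GRing.isMonoidMorphism.Build F alg_quot aclass aclass_monoid_morphism.

Lemma alg_quot_scaleAl (c : k) (p q : alg_quot) : c *: (p * q) = c *: p * q.
Proof.
rewrite -[p]areprK -[q]areprK -rmorphM -!linearZ -rmorphM.
by rewrite scalerAl.
Qed.

Lemma alg_quot_scaleAr (c : k) (p q : alg_quot) : c *: (p * q) = p * (c *: q).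
Proof.
rewrite -[p]areprK -[q]areprK -rmorphM -!linearZ -rmorphM.
by rewrite scalerAr.
Qed.

End QuotientAlgebra.

Lemma bilinear_mul_ring (k : comNzRingType) (Z : nzRingType) (M : lmodType k)
    (mul : M -> M -> M) (b : Z -> M) :
    left_distributive mul +%R -> right_distributive mul +%R ->
    (forall c u v, mul (c *: u) v = c *: mul u v) ->
    (forall c u v, mul u (c *: v) = c *: mul u v) ->
    (forall p q, mul (b p) (b q) = b (p * q)) ->
    (forall P : M -> Prop, P 0 -> (forall c p u, P u -> P (c *: b p + u)) ->
       forall u, P u) ->
  [/\ associative mul, left_id (b 1) mul & right_id (b 1) mul].
Proof.
move=> mDl mDr mZl mZr mb ind.
have m0l v : mul 0 v = 0 by have := mZl 0 0 v; rewrite !scale0r.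
have m0r v : mul v 0 = 0 by have := mZr 0 v 0; rewrite !scale0r.
have mE := (mDl, mDr, mZl, mZr, mb, m0l, m0r).
split; first (move=> u v w; elim/ind: u => [|c p u IHu]; rewrite !mE //).
- rewrite IHu; congr (_ *: _ + _).
  elim/ind: v {u IHu} => [|d q v IHv]; rewrite !mE //.
  rewrite IHv; congr (_ *: _ + _).
  by elim/ind: w {v IHv} => [|e r w IHw]; rewrite !mE // IHw mulrA.
- by elim/ind => [|c p u IHu]; rewrite !mE // IHu mul1r.
- by elim/ind => [|c p u IHu]; rewrite !mE // IHu mulr1.
Qed.

(* The algebra k[Z] of the multiplicative monoid of Z.                        *)
Section MonoidAlgebra.
Variables (k : comNzRingType) (Z : nzRingType).

Definition mon_alg : Type := {malg k[Z]}.

HB.instance Definition _ := GRing.Lmodule.on mon_alg.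

Definition mon (z : Z) : mon_alg := << z >>.

Definition mon_mul (u v : mon_alg) : mon_alg :=
  linear_ext (fun p => linear_ext (fun q => mon (p * q)) v) u.

Lemma mon_mulDl : left_distributive mon_mul +%R.
Proof. by move=> u v w; apply: (raddfD (linear_ext _)). Qed.

Lemma mon_mulDr : right_distributive mon_mul +%R.
Proof.
move=> u v w; rewrite /mon_mul /linear_ext -big_split; apply: eq_bigr => p _ /=.
by rewrite -scalerDr; congr (_ *: _); apply: (raddfD (linear_ext _)).
Qed.

Lemma mon_mulZl c u v : mon_mul (c *: u) v = c *: mon_mul u v.
Proof. exact: (linearZZ (linear_ext _)). Qed.

Lemma mon_mulZr c u v : mon_mul u (c *: v) = c *: mon_mul u v.
Proof.
rewrite /mon_mul /linear_ext scaler_sumr; apply: eq_bigr => p _ /=.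
rewrite scalerA mulrC -scalerA; congr (_ *: _).
exact: (linearZZ (linear_ext _)).
Qed.

Lemma mon_mulUU p q : mon_mul (mon p) (mon q) = mon (p * q).
Proof. by rewrite /mon_mul !linear_extU !scale1r. Qed.

Lemma mon_alg_ind (P : mon_alg -> Prop) :
  P 0 -> (forall c p u, P u -> P (c *: mon p + u)) ->
  forall u, P u.
Proof.
move=> P0 PD u; rewrite [u](@monalgE _ k).
elim: (enum_fset _) => [|p s IHs]; first by rewrite big_nil.
rewrite big_cons -[u@_p]mulr1 -malgZU.
exact: (PD u@_p p _ IHs).
Qed.

Let mon_span := bilinear_mul_ring mon_mulDl mon_mulDr mon_mulZl mon_mulZr
  mon_mulUU mon_alg_ind.

Fact mon_mulA : associative mon_mul. Proof. by case: mon_span. Qed.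

Fact mon_mul1 : left_id (mon 1) mon_mul.
Proof. exact: (let: And3 _ H _ := mon_span in H). Qed.

Fact mon_mulr1 : right_id (mon 1) mon_mul.
Proof. by case: mon_span. Qed.

Fact mon_one_neq0 : (mon 1) != 0.
Proof. by rewrite monalgU_eq0 oner_neq0. Qed.

HB.instance Definition _ := GRing.Zmodule_isNzRing.Build mon_alg
  mon_mulA mon_mul1 mon_mulr1 mon_mulDl mon_mulDr mon_one_neq0.

Fact mon_scaleAl c (u v : mon_alg) : c *: (u * v) = c *: u * v.
Proof. exact/esym/mon_mulZl. Qed.

HB.instance Definition _ :=
  GRing.Lmodule_isLalgebra.Build k mon_alg mon_scaleAl.

Fact mon_scaleAr c (u v : mon_alg) : c *: (u * v) = u * (c *: v).
Proof. exact/esym/mon_mulZr. Qed.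

HB.instance Definition _ :=
  GRing.Lalgebra_isAlgebra.Build k mon_alg mon_scaleAr.

End MonoidAlgebra.

(* Inside k[A x B] the bilinearity relations span a two-sided ideal, so the   *)
(* quotient is the module A (x) B with (a (x) b)(a' (x) b') = aa' (x) bb'.    *)
Section Tensor.
Variables (k : comNzRingType) (A B : algType k).

Local Notation "a # b" := (mon k ((a, b) : (A * B)%type))
  (at level 35, no associativity).

Inductive tensor_rel : mon_alg k (A * B)%type -> Prop :=
| tensor_relDl a a' b : tensor_rel ((a + a') # b - (a # b + a' # b))
| tensor_relDr a b b' : tensor_rel (a # (b + b') - (a # b + a # b'))
| tensor_relZl c a b : tensor_rel ((c *: a) # b - c *: (a # b))
| tensor_relZr c a b : tensor_rel (a # (c *: b) - c *: (a # b)).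

Definition tensor : Type := alg_quot tensor_rel.

HB.instance Definition _ := GRing.Lmodule.on tensor.
HB.instance Definition _ := GRing.PzRing.on tensor.

Definition tens (a : A) (b : B) : tensor := aclass tensor_rel (a # b).

End Tensor.

Section ConverseAlgebra.
Variables (k : comNzRingType) (A : algType k).

HB.instance Definition _ := GRing.Zmodule_isLmodule.Build k A^c
  (@scalerA k A) (@scale1r k A) (@scalerDr k A) (@scalerDl k A).

Fact converse_scaleAl c (a b : A^c) : c *: (a * b) = c *: a * b.
Proof. exact: (@scalerAr k A c b a). Qed.

HB.instance Definition _ :=
  GRing.Lmodule_isLalgebra.Build k A^c converse_scaleAl.

Fact converse_scaleAr c (a b : A^c) : c *: (a * b) = a * (c *: b).
Proof. exact: (@scalerAl k A c b a). Qed.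

HB.instance Definition _ :=
  GRing.Lalgebra_isAlgebra.Build k A^c converse_scaleAr.

End ConverseAlgebra.

Section Enveloping.
Variables (k : comNzRingType) (A : algType k).

Definition env_alg : Type := tensor A A^c.

HB.instance Definition _ := GRing.Lmodule.on env_alg.
HB.instance Definition _ := GRing.PzRing.on env_alg.

(* The action (a (x) b) m = a m b; the product a m b is taken in A.           *)
Definition bimod_act (u : mon_alg k (A * A^c)%type) (m : A) : A :=
  linear_ext (fun p : A * A^c => p.1 * m * (p.2 : A)) u.

Lemma bimod_actU a b m :
  bimod_act (mon k ((a, b) : (A * A^c)%type)) m = a * m * (b : A).
Proof. by rewrite /bimod_act linear_extU scale1r. Qed.

Lemma bimod_act_linear u : linear (bimod_act u).
Proof.
move=> c m n; rewrite /bimod_act /linear_ext scaler_sumr -big_split.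
apply: eq_bigr => p _ /=; rewrite mulrDr mulrDl scalerDr.
by rewrite -scalerAr -scalerAl !scalerA mulrC.
Qed.

HB.instance Definition _ u :=
  GRing.isLinear.Build k A A _ (bimod_act u) (bimod_act_linear u).

Lemma bimod_actD m : {morph bimod_act^~ m : u v / u + v}.
Proof. by move=> u v; apply: (raddfD (linear_ext _)). Qed.

Lemma bimod_actB m : {morph bimod_act^~ m : u v / u - v}.
Proof. by move=> u v; apply: (raddfB (linear_ext _)). Qed.

Lemma bimod_actZ c u m : bimod_act (c *: u) m = c *: bimod_act u m.
Proof. exact: (linearZZ (linear_ext _)). Qed.

Lemma bimod_act0 m : bimod_act 0 m = 0.
Proof. exact: (raddf0 (linear_ext _)). Qed.

Lemma bimod_actP c u v m :
  bimod_act (c *: u + v) m = c *: bimod_act u m + bimod_act v m.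
Proof. by rewrite bimod_actD bimod_actZ. Qed.

Lemma bimod_actM u v m : bimod_act (u * v) m = bimod_act u (bimod_act v m).
Proof.
elim/mon_alg_ind: u => [|c [a a'] u IHu].
  by rewrite mul0r !bimod_act0.
set x := mon k _; rewrite (mulrDl (c *: x) u v) -(scalerAl c x v).
apply: etrans (bimod_actP c (x * v) (u * v) m) _.
apply: etrans _ (esym (bimod_actP c x u (bimod_act v m))).
congr (_ + _); last exact: IHu.
congr (_ *: _); elim/mon_alg_ind: v {u IHu} => [|d [b b'] v IHv].
  by rewrite mulr0 !bimod_act0 raddf0.
set y := mon k _; rewrite (mulrDr x (d *: y) v) -(scalerAr d x y).
apply: etrans (bimod_actP d (x * y) (x * v) m) _.
rewrite (bimod_actP d y v m) linearP; congr (_ + _); last exact: IHv.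
congr (_ *: _); have -> : x * y = mon k (a * b, a' * b') by apply: mon_mulUU.
apply: etrans (bimod_actU (a * b) (a' * b') m) _.
apply: etrans _ (esym (congr1 (bimod_act x) (bimod_actU b b' m))).
apply: etrans _ (esym (bimod_actU a a' _)).
have E (e f g h : A) : e * f * m * (g * h) = e * (f * m * g) * h.
  by rewrite !mulrA.
exact: E.
Qed.

Lemma bimod_act_rel u m :
  ideal_gen (@tensor_rel k A A^c) u -> bimod_act u m = 0.
Proof.
have E1 (e f g h : A) : (e + f) * g * h - (e * g * h + f * g * h) = 0.
  by rewrite !mulrDl subrr.
have E2 (e f g h : A) : e * g * (f + h) - (e * g * f + e * g * h) = 0.
  by rewrite mulrDr subrr.
have E3 c (e f g : A) : c *: e * f * g - c *: (e * f * g) = 0.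
  by rewrite -!scalerAl subrr.
have E4 c (e f g : A) : e * f * (c *: g) - c *: (e * f * g) = 0.
  by rewrite -scalerAr subrr.
have U a b n := bimod_actU a b n.
have B u v n := bimod_actB n u v.
have D u v n := bimod_actD n u v.
have rel0 g n : tensor_rel g -> bimod_act g n = 0.
  case=> [a a' b|a b b'|c a b|c a b]; apply: etrans (B _ _ n) _.
  - by rewrite D (U (a + a') b) (U a b) (U a' b); apply: E1.
  - by rewrite D (U a (b + b')) (U a b) (U a b'); apply: E2.
  - by rewrite bimod_actZ (U (c *: a) b) (U a b); apply: E3.
  - by rewrite bimod_actZ (U a (c *: b)) (U a b); apply: E4.
elim=> [|v g w Sg|v w _ IHv _ IHw]; first exact: bimod_act0.
  apply: etrans (bimod_actM _ _ m) _.
  apply: etrans (bimod_actM _ _ _) _.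
  apply: etrans (congr1 (bimod_act v) (rel0 g _ Sg)) _.
  exact: (raddf0 (bimod_act v)).
by apply: etrans (D v w m) _; rewrite IHv IHw addr0.
Qed.

Definition bimod : Type := A.

HB.instance Definition _ := GRing.Zmodule.on bimod.

Definition bimod_scale (t : env_alg) (m : bimod) : bimod :=
  bimod_act (arepr t) m.

Lemma bimod_scaleE u m : bimod_scale (aclass _ u) m = bimod_act u m.
Proof.
apply/subr0_eq; rewrite -(bimod_actB m); apply: bimod_act_rel.
exact: areprB.
Qed.

Fact bimod_scaleA s t m :
  bimod_scale s (bimod_scale t m) = bimod_scale (s * t) m.
Proof.
by rewrite -[s]areprK -[t]areprK -rmorphM !bimod_scaleE bimod_actM.
Qed.

Fact bimod_scale1 : left_id 1 bimod_scale.
Proof.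
move=> m; rewrite -[1](rmorph1 (aclass (@tensor_rel k A A^c))) bimod_scaleE.
by rewrite bimod_actU mul1r mulr1.
Qed.

Fact bimod_scaleDr : right_distributive bimod_scale +%R.
Proof. by move=> t m n; rewrite /bimod_scale raddfD. Qed.

Fact bimod_scaleDl m : {morph bimod_scale^~ m : s t / s + t}.
Proof.
move=> s t; rewrite -[s]areprK -[t]areprK -raddfD !bimod_scaleE.
exact: bimod_actD.
Qed.

HB.instance Definition _ := GRing.Zmodule_isLmodule.Build env_alg bimod
  bimod_scaleA bimod_scale1 bimod_scaleDr bimod_scaleDl.

Lemma bimodE (a b : A) (m : bimod) :
  (tens a (b : A^c) : env_alg) *: m = (a * m * b : A).
Proof. by rewrite [LHS]bimod_scaleE bimod_actU. Qed.

Fact env_alg_neq0 : (1 : env_alg) != 0.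
Proof.
pose e : bimod := (1 : A); apply/eqP=> /(congr1 (fun t : env_alg => t *: e)).
by rewrite scale1r scale0r; apply/eqP; apply: oner_neq0.
Qed.

HB.instance Definition _ :=
  GRing.PzSemiRing_isNonZero.Build env_alg env_alg_neq0.

HB.instance Definition _ := GRing.Lmodule_isLalgebra.Build k env_alg
  (@alg_quot_scaleAl _ _ (@tensor_rel k A A^c)).

HB.instance Definition _ := GRing.Lalgebra_isAlgebra.Build k env_alg
  (@alg_quot_scaleAr _ _ (@tensor_rel k A A^c)).

End Enveloping.

(* Restriction of scalars along k -> R.                                       *)
Section RestrictScalars.
Variables (k : comNzRingType) (R : algType k) (N : lmodType R).

Definition res_scalars : Type := N.

HB.instance Definition _ := GRing.Zmodule.on res_scalars.

Definition res_scale (c : k) (n : res_scalars) : res_scalars := c%:A *: (n : N).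

Fact res_scaleA a b n : res_scale a (res_scale b n) = res_scale (a * b) n.
Proof. by rewrite /res_scale scalerA -scalerAl mul1r scalerA. Qed.

Fact res_scale1 : left_id 1 res_scale.
Proof. by move=> n; rewrite /res_scale !scale1r. Qed.

Fact res_scaleDr : right_distributive res_scale +%R.
Proof. by move=> a m n; rewrite /res_scale scalerDr. Qed.

Fact res_scaleDl n : {morph res_scale^~ n : a b / a + b}.
Proof. by move=> a b; rewrite /res_scale !scalerDl. Qed.

HB.instance Definition _ := GRing.Zmodule_isLmodule.Build k res_scalars
  res_scaleA res_scale1 res_scaleDr res_scaleDl.

End RestrictScalars.

(* Hom_R(M, N) as a k-module, for a k-algebra R.                              *)
Section HomModule.
Variables (k : comNzRingType) (R : algType k) (M N : lmodType R).

Definition hom_pred : pred (M -> res_scalars N) :=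
  fun f => `[< linear (f : M -> N) >].

Fact hom_pred_submod : submod_closed hom_pred.
Proof.
split=> [|c f g /asboolP lf /asboolP lg]; apply/asboolP.
  by move=> a m n; rewrite /= scaler0 addr0.
move=> a m n; have := lf a m n; have := lg a m n.
rewrite [(c *: f + g) _]/(c%:A *: (f _ : N) + g _ : N) => -> ->.
rewrite [(c *: f + g) m]/(c%:A *: (f _ : N) + g _ : N).
rewrite [(c *: f + g) n]/(c%:A *: (f _ : N) + g _ : N).
by rewrite !scalerDr !scalerA -scalerAl mul1r -scalerAr mulr1 addrACA.
Qed.

Record Hom := MkHom { hom_val : M -> res_scalars N; _ : hom_pred hom_val }.

HB.instance Definition _ := [isSub for hom_val].
HB.instance Definition _ := [Choice of Hom by <:].
HB.instance Definition _ := GRing.SubChoice_isSubLmodule.Build k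
  (M -> res_scalars N) hom_pred Hom (GRing.submod_closed_semi hom_pred_submod).

Definition hom_fun (f : Hom) : M -> N := hom_val f.

Fact hom_fun_linear f : linear (hom_fun f).
Proof. by case: f => f lf; apply/asboolP. Qed.

HB.instance Definition _ f :=
  GRing.isLinear.Build R M N _ (hom_fun f) (hom_fun_linear f).

Definition hom_of (f : {linear M -> N}) : Hom :=
  MkHom (asboolT (@linearP _ _ _ _ f) : hom_pred f).

Lemma homP (f g : Hom) : hom_fun f =1 hom_fun g <-> f = g.
Proof. by split=> [fg|->//]; apply/val_inj/funext. Qed.

End HomModule.

Section HomPrecomposition.
Variables (k : comNzRingType) (R : algType k) (M M' N : lmodType R).
Variable d : {linear M' -> M}.

Definition precomp (f : Hom M N) : Hom M' N :=
  hom_of [the {linear M' -> N} of hom_fun f \o d].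

Fact precomp_linear : linear precomp.
Proof. by move=> c f g; apply/homP. Qed.

HB.instance Definition _ :=
  GRing.isLinear.Build k (Hom M N) (Hom M' N) _ precomp precomp_linear.

End HomPrecomposition.

Definition projective (R : pzRingType) (P : lmodType R) : Prop :=
  forall (M N : lmodType R) (g : {linear M -> N}) (f : {linear P -> N}),
    (forall n, exists m, g m = n) ->
    exists h : {linear P -> M}, forall p, g (h p) = f p.

Record proj_resolution (R : pzRingType) (M : lmodType R) := ProjResolution {
  res_mod :> nat -> lmodType R;
  res_diff : forall n, {linear res_mod n.+1 -> res_mod n};
  res_aug : {linear res_mod 0%N -> M};
  res_proj : forall n, projective (res_mod n);
  res_aug_surj : forall m, exists p, res_aug p = m;
  res_exact0 : forall p, res_aug p = 0 <-> exists q, res_diff 0 q = p;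
  res_exact : forall n p,
    res_diff n p = 0 <-> exists q, res_diff n.+1 q = p
}.

(* The resolution with P_0 free on the set M and P_{n+1} free on the set      *)
(* ker (P_n -> P_{n-1}), where P_{-1} = M.                                    *)
Section FreeResolution.
Variable R : nzRingType.

Record linear_arrow := LinearArrow {
  arrow_dom : lmodType R;
  arrow_cod : lmodType R;
  arrow_map :> {linear arrow_dom -> arrow_cod}
}.

Definition ker_type (f : linear_arrow) : Type := {x : arrow_dom f | f x == 0}.
HB.instance Definition _ f := Choice.on (ker_type f).

Definition free_cover (M : lmodType R) : linear_arrow :=
  LinearArrow [the {linear {malg R[M]} -> M} of linear_ext (fun m : M => m)].

Definition free_ker_cover (f : linear_arrow) : linear_arrow :=
  LinearArrow
    [the {linear {malg R[ker_type f]} -> arrow_dom f} of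
       linear_ext (fun x : ker_type f => sval x)].

Definition free_res_arrow (M : lmodType R) (n : nat) : linear_arrow :=
  iter n free_ker_cover (free_cover M).

Lemma free_projective (X : choiceType) : projective {malg R[X]}.
Proof.
move=> M N g f g_surj.
have [h hE] := choice (fun x => g_surj (f << x >>)).
exists [the {linear {malg R[X]} -> M} of linear_ext h].
apply: (malg_linear_eq (f := [the {linear _ -> _} of g \o linear_ext h])) => x.
by rewrite /= linear_extU scale1r hE.
Qed.

Lemma free_ker_cover_exact (f : linear_arrow) x :
  f x = 0 <-> exists u, free_ker_cover f u = x.
Proof.
split=> [/eqP fx0|[u <-]].
  exists << (exist _ x fx0 : ker_type f) >>.
  by rewrite /= linear_extU scale1r.
have := @malg_linear_eq R (ker_type f) (arrow_cod f)
  [the {linear _ -> _} of f \o linear_ext (fun x : ker_type f => sval x)]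
  [the {linear _ -> _} of \0].
apply=> -[y fy0]; rewrite /= linear_extU scale1r; exact/eqP.
Qed.

Lemma free_cover_surj (M : lmodType R) m : exists u, free_cover M u = m.
Proof. by exists << m >>; rewrite /= linear_extU scale1r. Qed.

Lemma free_res_projective (M : lmodType R) n :
  projective (arrow_dom (free_res_arrow M n)).
Proof. by case: n => [|n]; apply: free_projective. Qed.

Definition free_resolution (M : lmodType R) : proj_resolution M :=
  @ProjResolution R M (fun n => arrow_dom (free_res_arrow M n))
    (fun n => arrow_map (free_res_arrow M n.+1))
    (arrow_map (free_res_arrow M 0))
    (@free_res_projective M)
    (@free_cover_surj M)
    (@free_ker_cover_exact (free_res_arrow M 0))
    (fun n => @free_ker_cover_exact (free_res_arrow M n.+1)).

End FreeResolution.

(* The cohomology of the complex Hom_R(P_n, N), n >= 0.                       *)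
Section Ext.
Variables (k : comNzRingType) (R : algType k) (M N : lmodType R).
Variable P : proj_resolution M.

Definition cochain (n : nat) : lmodType k := Hom (P n) N.

Definition codiff (n : nat) : {linear cochain n -> cochain n.+1} :=
  @precomp k R _ _ N (res_diff P n).

Definition cocycle_pred n : pred (cochain n) := fun f => codiff n f == 0.

Fact cocycle_pred_submod n : submod_closed (@cocycle_pred n).
Proof.
split=> [|c f g /eqP f0 /eqP g0]; apply/eqP; first exact: raddf0.
by rewrite linearP f0 g0 scaler0 addr0.
Qed.

Record cocycle n :=
  Cocycle { cocycle_val : cochain n; _ : cocycle_pred cocycle_val }.

HB.instance Definition _ n := [isSub for @cocycle_val n].
HB.instance Definition _ n := [Choice of cocycle n by <:].
HB.instance Definition _ n := GRing.SubChoice_isSubLmodule.Build k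
  (cochain n) (@cocycle_pred n) (cocycle n)
  (GRing.submod_closed_semi (@cocycle_pred_submod n)).

Definition coboundary n : cochain n -> Prop :=
  if n is m.+1 then fun f => exists g, f = codiff m g else fun f => f = 0.

Definition coboundary_pred n : pred (cocycle n) :=
  fun f => `[< coboundary (cocycle_val f) >].

Fact coboundary_pred_submod n : submod_closed (@coboundary_pred n).
Proof.
have cvalP c (f g : cocycle n) :
    cocycle_val (c *: f + g) = c *: cocycle_val f + cocycle_val g by [].
split=> [|c f g /asboolP Bf /asboolP Bg]; apply/asboolP; rewrite ?cvalP.
  by case: n {cvalP} => [|n] //; exists 0; rewrite raddf0.
case: n f g Bf Bg {cvalP} => [|n] f g /= => [-> ->|[f' ->] [g' ->]].
  by rewrite scaler0 addr0.
by exists (c *: f' + g'); rewrite linearP.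
Qed.

Definition Ext_via n : lmodType k := lquot (@coboundary_pred_submod n).

End Ext.

Definition Ext (k : comNzRingType) (R : algType k) (n : nat)
    (M N : lmodType R) : lmodType k :=
  Ext_via N (free_resolution M) n.

(* Hochschild cohomology sits in non-positive degrees: HH^{-n} = Ext^n, and   *)
(* HH^i = 0 for i > 0.                                                        *)
Definition HH (k : comNzRingType) (A : algType k) (i : int) : lmodType k :=
  match i with
  | Posz 0 => Ext 0 (bimod A) (bimod A)
  | Posz _.+1 => 'rV[k]_0
  | Negz n => Ext n.+1 (bimod A) (bimod A)
  end.

Lemma malg_scaleAr (k : comNzRingType) (K : monomType) (c : k)
    (u v : {malg k[K]}) :
  c *: (u * v) = u * (c *: v).
Proof.
have cE : c%:MP * u = u * c%:MP :> {malg k[K]}.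
  rewrite [LHS]fgmulUg [RHS]fgmulgU; apply: eq_bigr => x _.
  by rewrite mul1m mulm1 mulrC.
by rewrite -(mul_malgC c v) mulrA -cE -mulrA mul_malgC.
Qed.

Section FreeAlgebra.
Variables (k : comNzRingType) (X : choiceType).

Definition free_alg : Type := {malg k[{fmonom X}]}.

HB.instance Definition _ := GRing.Lalgebra.on free_alg.

Fact free_alg_scaleAr c (u v : free_alg) : c *: (u * v) = u * (c *: v).
Proof. exact: malg_scaleAr. Qed.

HB.instance Definition _ :=
  GRing.Lalgebra_isAlgebra.Build k free_alg free_alg_scaleAr.

Definition free_gen (x : X) : free_alg := << fmu x >>.

Definition free_aug (u : free_alg) : k := mcoeff (mone : {fmonom X}) u.

HB.instance Definition _ := GRing.isZmodMorphism.Build free_alg k free_aug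
  (raddfB (mcoeff (mone : {fmonom X}))).

Fact free_aug_monoid_morphism : monoid_morphism free_aug.
Proof.
split; first exact: (rmorph1 (mcoeff (mone : {fmonom X}))).
exact: (rmorphM (mcoeff (mone : {fmonom X}))).
Qed.

HB.instance Definition _ := GRing.isMonoidMorphism.Build free_alg k free_aug
  free_aug_monoid_morphism.

Lemma free_aug_gen x : free_aug (free_gen x) = 0.
Proof. by rewrite /free_aug mcoeffU -fdeg_eq0 fdegU. Qed.

End FreeAlgebra.

(* k<x, y, z> / (x^2 + y x, x z, z y)                                         *)
Section AlgebraA.
Variable k : fieldType.

Local Notation F := (free_alg k 'I_3).
Local Notation x := (free_gen k (@Ordinal 3 0 isT)).
Local Notation y := (free_gen k (@Ordinal 3 1 isT)).
Local Notation z := (free_gen k (@Ordinal 3 2 isT)).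

Inductive A_rel : F -> Prop :=
| A_rel_xx : A_rel (x ^+ 2 + y * x)
| A_rel_xz : A_rel (x * z)
| A_rel_zy : A_rel (z * y).

Definition algA : Type := alg_quot A_rel.

HB.instance Definition _ := GRing.Lmodule.on algA.
HB.instance Definition _ := GRing.PzRing.on algA.

Fact algA_one_neq0 : (1 : algA) != 0.
Proof.
have augM (u v : F) : free_aug (u * v) = free_aug u * free_aug v.
  exact: rmorphM.
have augD (u v : F) : free_aug (u + v) = free_aug u + free_aug v.
  exact: raddfD.
have aug0 (u : F) : ideal_gen A_rel u -> free_aug u = 0.
  elim=> [|a g b Sg|v w _ IHv _ IHw]; first exact: raddf0.
    rewrite (augM (a * g) b) (augM a g); suff -> : free_aug g = 0.
      by rewrite mulr0 mul0r.
    have genM i (v : F) : free_aug (free_gen k i * v) = 0.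
      by rewrite augM free_aug_gen mul0r.
    case: Sg; try exact: genM.
    apply: etrans (augD (x ^+ 2) (y * x)) _.
    apply: etrans (congr2 +%R (genM _ x) (genM _ x)) _.
    exact: addr0.
  by rewrite (augD v w) IHv IHw addr0.
apply/eqP; rewrite -[1]/(aclass A_rel 1) -[0](raddf0 (aclass A_rel)).
move/aclassP/aug0; rewrite subr0 rmorph1; apply/eqP; exact: oner_neq0.
Qed.

HB.instance Definition _ :=
  GRing.PzSemiRing_isNonZero.Build algA algA_one_neq0.

HB.instance Definition _ := GRing.Lmodule_isLalgebra.Build k algA
  (@alg_quot_scaleAl _ _ A_rel).

HB.instance Definition _ := GRing.Lalgebra_isAlgebra.Build k algA
  (@alg_quot_scaleAr _ _ A_rel).

End AlgebraA.

(* Main.v *)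
From HB Require Import structures.
Require Import Defs.
From mathcomp Require Import all_boot all_order all_algebra.
From mathcomp Require Import boolp finmap.
From mathcomp.multinomials Require Import monalg.

(** Ext^0 of M with itself is End(M), so HH^0(A) is the center of A. For the
    center, A has the Groebner basis yx + x^2, xz, zy, zx^2, hence a basis of
    normal words. Let v be the normal form of a central element. If t is a
    normal word ending in a, with (a, g) one of (z, z), (z, x), (y, z), (x, y),
    then t g is normal and comes from no other word of v, so the coefficient
    of t in v is that of t g in v g = g v. This forces the coefficients of all
    nonempty words to vanish. *)

Set Implicit Arguments.
Unset Strict Implicit.
Unset Printing Implicit Defensive.

Import GRing.Theory.
Local Open Scope ring_scope.

(** * Degree 0 Ext, endomorphisms and the center *)

Lemma inj_surj_bijective (T U : Type) (f : T -> U) :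
  injective f -> (forall u, exists t, f t = u) -> bijective f.
Proof.
move=> f_inj /choice[g fg]; exists g => // t.
by apply: f_inj; rewrite fg.
Qed.

Section ScalarExt0.
Variables (k : comNzRingType) (R : algType k) (M : lmodType R).
Variable P : proj_resolution M.

(** By exactness [q - r] lies in the image of the differential, which a cocycle kills; so a degree 0
    cocycle factors through the augmentation. *)
Lemma cocycle0_aug_eq (N : lmodType R) (f : cocycle N P 0) (q r : P 0%N) :
  res_aug P q = res_aug P r ->
  hom_fun (cocycle_val f) q = hom_fun (cocycle_val f) r.
Proof.
move=> qr; have /res_exact0[s sE] : res_aug P (q - r) = 0.
  by rewrite raddfB /= qr subrr.
rewrite -[q](subrK r) -sE linearD /=.
case: f => f /= /eqP/homP/(_ s) fd0.
by rewrite [X in X + _]fd0 add0r.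
Qed.

Let aug_hom : cochain M P 0 := hom_of (res_aug P).

Let aug_cocycle_pred : cocycle_pred aug_hom.
Proof.
apply/eqP/homP => q.
by apply/(res_exact0 (res_diff P 0 q)); exists q.
Qed.

Let aug_cocycle : cocycle M P 0 := Cocycle aug_cocycle_pred.

Let scaled_aug (c : k^o) : Ext_via M P 0 := lclass _ ((c : k) *: aug_cocycle).

Let scaled_aug_linear : linear scaled_aug.
Proof.
move=> c a b.
by rewrite /scaled_aug scalerDl -linearP /= -scalerA.
Qed.

Let scaled_aug_lin : {linear k^o -> Ext_via M P 0} :=
  HB.pack scaled_aug
    (GRing.isLinear.Build k k^o (Ext_via M P 0) _ scaled_aug scaled_aug_linear).

(** The map sends [c] to [c] times the class of the augmentation. Injectivity: degree 0 coboundaries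
    are zero and the augmentation is onto. Surjectivity: a cocycle descends to an endomorphism of
    [M]. *)
Lemma Ext0_bijective_of_scalar_end :
  (forall g : {linear M -> M}, exists c : k, forall m, g m = c%:A *: m) ->
  (forall c : k, (forall m : M, c%:A *: m = 0) -> c = 0) ->
  exists f : {linear k^o -> Ext_via M P 0}, bijective f.
Proof.
move=> endM faithM; exists scaled_aug_lin; apply: inj_surj_bijective.
  move=> c d /lclassP/asboolP /= /homP.
  rewrite -scalerBl => cd0; apply/subr0_eq/faithM => m.
  have [q <-] := res_aug_surj P m.
  exact: cd0 q.
move=> F; rewrite -[F]lreprK; set f := lrepr F.
(* [s] is only a set-theoretic section; [g] is linear because a cocycle sees its argument only
   through the augmentation. *)
have [s sE] := choice (res_aug_surj P).
pose g (m : M) : M := hom_fun (cocycle_val f) (s m).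
have g_linear : linear g.
  move=> c m n; rewrite /g -linearP; apply: cocycle0_aug_eq.
  by rewrite linearP /= !sE.
have [c cE] := endM (HB.pack g (GRing.isLinear.Build R M M _ g g_linear)).
exists c; congr lclass; apply/val_inj/homP => q.
apply: etrans (esym (cE (res_aug P q))) _.
by apply: cocycle0_aug_eq; rewrite sE.
Qed.

End ScalarExt0.

(** A bimodule endomorphism [g] satisfies [g (a * b) = a * g 1 * b], so [g 1] is central and
    determines [g]. *)
Lemma HH0_bijective_of_scalar_center (k : comNzRingType) (A : algType k) :
  (forall m : A, (forall a, a * m = m * a) -> exists c : k, m = c%:A) ->
  injective (fun c : k => c%:A : A) ->
  exists f : {linear k^o -> HH A 0}, bijective f.
Proof.
move=> centerA kA_inj.
have scaleE (c : k) (m : bimod A) : c%:A *: m = (c *: (m : A) : A).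
  have -> : c%:A = aclass (@tensor_rel k A A^c) (c *: 1) :> env_alg A.
    exact: (esym (linearZZ (aclass (@tensor_rel k A A^c)) c 1)).
  apply: etrans (bimod_scaleE _ _) _.
  by rewrite bimod_actZ bimod_actU mul1r mulr1.
apply: Ext0_bijective_of_scalar_end => [g|c c0].
  have gE a b : g (a * b : A) = (a * g (1 : A) * b : A).
    rewrite -bimodE -linearZ bimodE; congr (g _).
    by rewrite mulr1.
  have [a|c cE] := centerA (g (1 : A)).
    by rewrite -[LHS]mulr1 -gE -[a * _]mul1r mulr1 gE mul1r.
  exists c => m; rewrite scaleE -[m in LHS]mulr1 gE cE mulr1.
  by rewrite mulr_algr.
by apply: kA_inj; rewrite -[LHS]scaleE c0 scale0r.
Qed.

(** * Coefficients of linear extensions; words in the free algebra *)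

Lemma malg_ind (R : nzRingType) (T : choiceType) (Q : {malg R[T]} -> Prop) :
  Q 0 -> (forall c x u, Q u -> Q (c *: << x >> + u)) -> forall u, Q u.
Proof.
move=> Q0 QD u; rewrite [u]monalgE.
elim: (enum_fset _) => [|x s IHs]; first by rewrite big_nil.
by rewrite big_cons -[u@_x]mulr1 -malgZU; apply: QD.
Qed.

Lemma mcoeff_linear_ext1 (R : nzRingType) (T T' : choiceType)
    (f : T -> {malg R[T']}) (u : {malg R[T]}) (y : T) (w : T') :
    (forall x, u@_x != 0 -> x != y -> (f x)@_w = 0) ->
  (linear_ext f u)@_w = u@_y * (f y)@_w.
Proof.
(* The index set is enlarged because [y] may lie outside the support of [u]. *)
move=> f0; rewrite (linear_extEw f (fsubsetUr [fset y]%fset (msupp u))).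
rewrite (big_fsetD1 y) /= ?fsetU11 // mcoeffD mcoeffZ raddf_sum /=.
rewrite big_seq big1 ?addr0 // => x /fsetD1P[xNy _].
rewrite mcoeffZ; have [->|ux0] := eqVneq u@_x 0; first by rewrite mul0r.
by rewrite f0 ?mulr0.
Qed.

Section FreeAlgebraWords.
Variables (k : comNzRingType) (T : choiceType).

Definition fword (s : seq T) : free_alg k T := << FMonom s >>.

Lemma free_alg_ind (Q : free_alg k T -> Prop) :
  Q 0 -> (forall c s u, Q u -> Q (c *: fword s + u)) -> forall u, Q u.
Proof. by move=> Q0 QD; apply: malg_ind => // c [s] u; apply: QD. Qed.

Lemma fwordM s t : fword s * fword t = fword (s ++ t).
Proof.
apply: etrans (fgmulUU _ _ _ _) _; rewrite mulr1.
by congr << _ >>; apply/eqP; rewrite fmP fmM.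
Qed.

Lemma fword0 : fword [::] = 1.
Proof. by congr << _ >>; apply/eqP; rewrite fmP fm1. Qed.

Lemma free_genE x : free_gen k x = fword [:: x].
Proof. by congr << _ >>; apply/eqP; rewrite fmP fmU. Qed.

End FreeAlgebraWords.

(** * Normal words and multiplication by letters *)

Inductive letter := X | Y | Z.

(** An inductive alphabet allows pattern matching on words; the generators of [algA] are indexed by
    ['I_3]. *)
Definition letter_ord (l : letter) : 'I_3 :=
  match l with
  | X => @Ordinal 3 0 isT
  | Y => @Ordinal 3 1 isT
  | Z => @Ordinal 3 2 isT
  end.

Definition ord_letter (i : 'I_3) : letter :=
  match val i with 0%N => X | 1%N => Y | _ => Z end.

Lemma letter_ordK : cancel letter_ord ord_letter.
Proof. by case. Qed.

Lemma ord_letterK : cancel ord_letter letter_ord.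
Proof. by move=> [[|[|[|i]]] lti] //; apply/val_inj. Qed.

HB.instance Definition _ := Choice.copy letter (can_type letter_ordK).

(* The leading words of the Groebner basis yx + x^2, xz, zy, zx^2 are yx, xz, *)
(* zy and zxx.                                                                *)
Definition prepends (g : letter) (w : seq letter) : bool :=
  match g, w with
  | X, Z :: _ | Y, X :: _ | Z, Y :: _ | Z, X :: X :: _ => false
  | _, _ => true
  end.

Fixpoint normal (w : seq letter) : bool :=
  if w is g :: w' then prepends g w' && normal w' else true.

Definition allowed (a g : letter) : bool :=
  match a, g with
  | Y, Z | Z, Z | Z, X | X, Y => true
  | _, _ => false
  end.

(** No leading word yx, xz, zy, zxx ends in an allowed pair, so appending [g] creates none. *)
Lemma normal_rcons s a g :
  normal (rcons s a) -> allowed a g -> normal (rcons (rcons s a) g).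
Proof.
elim: s => [|c s IHs] /=; first by case: a g => [] [].
case/andP=> cs /IHs sN ag; rewrite sN // andbT.
case: s cs ag {IHs sN} => [|d [|e s]]; first by case: c a g => [] [] [].
  by case: c d a g => [] [] [] [].
by case: c d e => [] [] [].
Qed.

Section Words.
Variable k : nzRingType.

Local Notation V := {malg k[seq letter]}.

(* Left multiplication by g in A, extended from normal words to all words so  *)
(* that the defining relations of A still hold.                               *)
Definition op (g : letter) (w : seq letter) : V :=
  match g, w with
  | X, Z :: _ | Z, Y :: _ | Z, X :: X :: _ => 0
  | Y, X :: _ => - << X :: w >>
  | _, _ => << g :: w >>
  end.

Lemma op_prepends g w : prepends g w -> op g w = << g :: w >>.
Proof. by case: g w => [] [|[] [|[] w]]. Qed.

Lemma opE g w : exists c h, op g w = << c *g h :: w >>.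
Proof.
suff [->|[->|->]] :
  op g w = 0 \/ op g w = << g :: w >> \/ op g w = - << X :: w >>.
- by exists 0, g; rewrite monalgU0.
- by exists 1, g.
- by exists (-1), X; rewrite monalgUN.
by case: g w => [] [|[] [|[] w]]; auto.
Qed.

(** The only nonzero rewriting turns yx... into -xx..., and x may precede any word that starts with
    x. *)
Lemma op_normal g w w' : normal w -> ~~ normal w' -> (op g w)@_w' = 0.
Proof.
move=> wN w'N; have [gw|gw] := boolP (prepends g w).
  by rewrite op_prepends // mcoeffU; case: eqP w'N => //= <-; rewrite /= gw wN.
case: g w gw wN => [] [|[] w] //= gw wN; rewrite ?mcoeff0 //; last first.
  by case: w gw {wN} => [|[] w]; rewrite ?mcoeff0.
by rewrite mcoeffN mcoeffU; case: eqP w'N => [<-|]; rewrite /= ?wN ?oppr0.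
Qed.

Definition act_word (s : seq letter) (v : V) : V :=
  foldr (fun g => linear_ext (op g)) v s.

Lemma act_word_linear s : linear (act_word s).
Proof.
elim: s => [|g s IHs] // c u v.
exact: etrans (congr1 (linear_ext (op g)) (IHs c u v)) (linearP _ _ _ _).
Qed.

HB.instance Definition _ s :=
  GRing.isLinear.Build k V V _ (act_word s) (act_word_linear s).

Lemma act_word_cat s t v : act_word (s ++ t) v = act_word s (act_word t v).
Proof. exact: foldr_cat. Qed.

Lemma act_word_normal s w :
  normal (s ++ w) -> act_word s << w >> = << s ++ w >>.
Proof.
elim: s => //= g s IHs /andP[gsw /IHs->].
by rewrite linear_extU scale1r op_prepends.
Qed.

(** Each letter either kills a word or puts one letter in front of it, up to a scalar, so the suffix
    [w] survives. *)
Lemma act_wordE s w : exists c t, act_word s << w >> = << c *g t ++ w >>.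
Proof.
elim: s => [|g s [c [t stE]]]; first by exists 1, [::].
have [d [h gE]] := opE g (t ++ w); exists (c * d), (h :: t).
by rewrite /= stE linear_extU gE malgZU.
Qed.

Lemma op_linear_normal g v :
    (forall w, ~~ normal w -> v@_w = 0) ->
  forall w, ~~ normal w -> (linear_ext (op g) v)@_w = 0.
Proof.
move=> vN w wN; rewrite /linear_ext raddf_sum big1 //= => t _; rewrite mcoeffZ.
have [tN|/vN->] := boolP (normal t); last by rewrite mul0r.
by rewrite op_normal ?mulr0.
Qed.

Lemma mcoeff_op_cons g v h w :
  (linear_ext (op g) v)@_(h :: w) = v@_w * (op g w)@_(h :: w).
Proof.
apply: mcoeff_linear_ext1 => t _ tw; have [c [h' ->]] := opE g t.
by rewrite mcoeffU eqseq_cons (negPf tw) andbF.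
Qed.

Lemma mcoeff_act_allowed v t a g :
    (forall w, ~~ normal w -> v@_w = 0) -> allowed a g ->
  (linear_ext (act_word^~ << [:: g] >>) v)@_(rcons (rcons t a) g)
    = v@_(rcons t a).
Proof.
move=> vN ag; have act_allowed s : normal (rcons s a) ->
    act_word (rcons s a) << [:: g] >> = << rcons (rcons s a) g >>.
  move=> sN; rewrite act_word_normal cats1 //.
  exact: normal_rcons.
have act0_coef w : normal w -> w != rcons t a ->
    (act_word w << [:: g] >>)@_(rcons (rcons t a) g) = 0.
  case/lastP: w => [|s b] sN sbt.
    by rewrite mcoeffU -[[:: g]]/(rcons [::] g) eqseq_rcons; case: t {sbt}.
  have [ba|bNa] := eqVneq b a.
    move: sN sbt; rewrite ba => sN sbt.
    by rewrite act_allowed // mcoeffU eqseq_rcons (negPf sbt).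
  (* For [b != a], bg is zero or a multiple of hg with [h != a]: the one sign change, yx = -xx, has
     [a = Z]. The letters of [s] keep the suffix hg, so a word ending in ag is never reached. *)
  have [c [h [bgE ch]]] : exists c h,
      op b [:: g] = << c *g [:: h; g] >> /\ (c = 0 \/ h != a).
    have [bg|] := boolP (prepends b [:: g]).
      by exists 1, b; rewrite op_prepends; auto.
    case: b g ag bNa {sN sbt act_allowed} => [] [] // ag _ _.
    - by exists 0, X; rewrite /= monalgU0; auto.
    - by exists (-1), X; rewrite /= monalgUN; split=> //; right; case: a ag.
    - by exists 0, X; rewrite /= monalgU0; auto.
  rewrite -[rcons s b]cats1 act_word_cat /= linear_extU scale1r bgE.
  rewrite -[c]mulr1 -malgZU linearZ /= mcoeffZ.
  have [d [u ->]] := act_wordE s [:: h; g].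
  case: ch => [->|ha]; first by rewrite mul0r.
  rewrite mcoeffU -[[:: h; g]]/([:: h] ++ [:: g]) catA !cats1 !eqseq_rcons.
  by rewrite (negPf ha) andbF mulr0.
rewrite (@mcoeff_linear_ext1 _ _ _ _ _ (rcons t a)) => [|w vw wt].
  have [tN|/vN->] := boolP (normal (rcons t a)); last by rewrite mul0r.
  by rewrite act_allowed // mcoeffU eqxx mulr1.
apply: act0_coef => //; apply: contraNT vw => /vN->.
by rewrite eqxx.
Qed.

(* A word ending in Z can be compared both at g = Z and at g = X, so it would *)
(* have to begin with Z and with X.  A word ending in Y, resp. X, is compared *)
(* at g = Z, resp. g = Y, with one ending in Z, resp. Y.                      *)
Lemma commuting_with_letters_const v :
    (forall w, ~~ normal w -> v@_w = 0) ->
    (forall g, linear_ext (act_word^~ << [:: g] >>) v = linear_ext (op g) v) ->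
  v = << v@_[::] *g [::] >>.
Proof.
move=> vN vC.
(* Compares the coefficients of [h :: rcons w g] in vg and gv. *)
have vE h w t a g : h :: w = rcons t a -> allowed a g ->
    v@_(h :: w) = v@_(rcons w g) * (op g (rcons w g))@_(h :: rcons w g).
  move=> hwE ag; rewrite -mcoeff_op_cons -vC -rcons_cons hwE.
  by rewrite mcoeff_act_allowed.
(* The hypothesis holds for x and z, which never change a letter; y may turn into x. *)
have op_head g w h : op g w = << g :: w >> \/ op g w = 0 -> h != g ->
    (op g w)@_(h :: w) = 0.
  by case=> ->; rewrite ?mcoeff0 // mcoeffU eqseq_cons eq_sym => /negPf->.
have vZ t : v@_(rcons t Z) = 0.
  case def_t: (rcons t Z) => [|h w]; first by case: t def_t.
  have [hX|hX] := eqVneq h X.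
    rewrite (@vE _ _ t Z Z) // op_head ?mulr0 ?hX //.
    by case: (rcons w Z) => [|[] [|[] w']] /=; auto.
  rewrite (@vE _ _ t Z X) // op_head ?mulr0 //.
  by case: (rcons w X) => [|[] w'] /=; auto.
have vY t : v@_(rcons t Y) = 0.
  case def_t: (rcons t Y) => [|h w]; first by case: t def_t.
  by rewrite (@vE _ _ t Y Z) // vZ mul0r.
have vX t : v@_(rcons t X) = 0.
  case def_t: (rcons t X) => [|h w]; first by case: t def_t.
  by rewrite (@vE _ _ t X Y) // vY mul0r.
apply/malgP => w; rewrite mcoeffU; case/lastP: w => [|t a] //=.
by case: a; rewrite ?vX ?vY ?vZ; case: t.
Qed.

End Words.

(** * Scalar center from a compatible action on words *)

Section ScalarCenter.
Variables (k : fieldType) (A : algType k) (gen : letter -> A).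

Local Notation V := {malg k[seq letter]}.

Hypothesis gen_yx : gen Y * gen X = - (gen X * gen X).
Hypothesis gen_xz : gen X * gen Z = 0.
Hypothesis gen_zy : gen Z * gen Y = 0.
Hypothesis gen_ind : forall Q : A -> Prop,
  Q 1 -> (forall g a, Q a -> Q (gen g * a)) -> Q 0 ->
  (forall c a b, Q a -> Q b -> Q (c *: a + b)) -> forall a, Q a.

Variable act : A -> V -> V.
Hypothesis actP : forall c a b v, act (c *: a + b) v = c *: act a v + act b v.
Hypothesis act1 : forall v, act 1 v = v.
Hypothesis actM_gen : forall g a v,
  act (gen g * a) v = linear_ext (op k g) (act a v).

Let act0 v : act 0 v = 0.
Proof. by have := actP (-1) 0 0 v; rewrite scaler0 addr0 scaleN1r addNr. Qed.

Let actM a b v : act (a * b) v = act a (act b v).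
Proof.
elim/gen_ind: a => [|g a IHa||c a a' IHa IHa'].
- by rewrite mul1r act1.
- by rewrite -mulrA !actM_gen IHa.
- by rewrite mul0r !act0.
- by rewrite mulrDl -scalerAl !actP IHa IHa'.
Qed.

Let eval (v : V) : A := linear_ext (fun w => \prod_(g <- w) gen g) v.

Let eval_linear : linear eval. Proof. exact: linear_ext_linear. Qed.

HB.instance Definition _ := GRing.isLinear.Build k V A _ eval eval_linear.

Let evalU w : eval << w >> = \prod_(g <- w) gen g.
Proof. by rewrite /eval linear_extU scale1r. Qed.

(** For [n] the normal form of an element and [v] a single letter, this computes right
    multiplication by that letter. *)
Let act_eval n v : act (eval n) v = linear_ext ((act_word (k := k))^~ v) n.
Proof.
have wordE w :
    act (eval << w >>) v = linear_ext ((act_word (k := k))^~ v) << w >>.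
  rewrite evalU linear_extU scale1r; elim: w => [|g w IHw].
    by rewrite big_nil act1.
  by rewrite big_cons actM_gen IHw.
elim/malg_ind: n => [|c w n IHn]; first by rewrite !raddf0 act0.
by rewrite eval_linear actP IHn wordE [RHS]linear_ext_linear.
Qed.

Let eval_op g w : eval (op k g w) = gen g * eval << w >>.
Proof.
(* zxx = -zyx = 0: the consequence of the relations that makes zxx a leading word. *)
have gen_zxx a : gen Z * (gen X * (gen X * a)) = 0.
  rewrite (mulrA (gen X)) -[gen X * gen X]opprK -gen_yx mulNr mulrN !mulrA.
  by rewrite gen_zy !mul0r oppr0.
have [gw|] := boolP (prepends g w).
  by rewrite op_prepends // !evalU big_cons.
case: g w => [] [|[] w] //; rewrite !evalU !big_cons.
- by rewrite mulrA gen_xz mul0r raddf0.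
- by rewrite raddfN /= evalU !big_cons [RHS]mulrA gen_yx mulNr mulrA.
- case: w => [|[] w] // _.
  by rewrite big_cons gen_zxx raddf0.
- by rewrite mulrA gen_zy mul0r raddf0.
Qed.

Let eval_opL g v : eval (linear_ext (op k g) v) = gen g * eval v.
Proof.
elim/malg_ind: v => [|c w v IHv]; first by rewrite !raddf0 mulr0.
rewrite linear_ext_linear !eval_linear IHv linear_extU scale1r eval_op.
by rewrite mulrDr scalerAr.
Qed.

(** The normal form: [eval] recovers [a] from it, and only normal words occur in it. *)
Let nf a := act a << [::] >>.

Let nfK a : eval (nf a) = a.
Proof.
rewrite /nf; elim/gen_ind: a => [|g a IHa||c a b IHa IHb].
- by rewrite act1 evalU big_nil.
- by rewrite actM_gen eval_opL IHa.
- by rewrite act0 raddf0.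
- by rewrite actP eval_linear IHa IHb.
Qed.

Let nf_normal a w : ~~ normal w -> (nf a)@_w = 0.
Proof.
rewrite /nf; elim/gen_ind: a w => [|g a IHa||c a b IHa IHb] w wN.
- by rewrite act1 mcoeffU; case: eqP wN => // <-.
- by rewrite actM_gen op_linear_normal.
- by rewrite act0 mcoeff0.
- by rewrite actP mcoeffD mcoeffZ IHa // IHb // mulr0 addr0.
Qed.

Lemma scalar_center_of_word_action (m : A) :
  (forall a, a * m = m * a) -> exists c : k, m = c%:A.
Proof.
move=> mC; exists (nf m)@_[::]; rewrite -[LHS]nfK.
rewrite [in LHS](commuting_with_letters_const (@nf_normal m)) => [|g].
  by rewrite -[(nf m)@__ in LHS]mulr1 -malgZU linearZ /= evalU big_nil.
(* Both sides are normal forms, of [m * gen g] and [gen g * m], which agree by centrality. *)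
rewrite -act_eval nfK /nf -actM_gen mC actM; congr (act m _).
by rewrite -[gen g]mulr1 actM_gen act1 linear_extU scale1r op_prepends; case: g.
Qed.

End ScalarCenter.

(** * Actions of the free algebra and of its quotients *)

Section FreeAction.
Variables (k : comNzRingType) (T : choiceType) (V : lmodType k).
Variable o : T -> {linear V -> V}.

Definition free_act (u : free_alg k T) (v : V) : V :=
  linear_ext (fun m : {fmonom T} => foldr (fun g => o g) v m) u.

Lemma foldr_linearP (s : seq T) c u v :
  foldr (fun g => o g) (c *: u + v) s
    = c *: foldr (fun g => o g) u s + foldr (fun g => o g) v s.
Proof. by elim: s => //= g s ->; rewrite linearP. Qed.

Lemma free_act_fword s v : free_act (fword k s) v = foldr (fun g => o g) v s.
Proof. by rewrite /free_act linear_extU scale1r. Qed.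

Lemma free_actPr u c v w :
  free_act u (c *: v + w) = c *: free_act u v + free_act u w.
Proof.
rewrite /free_act /linear_ext scaler_sumr -big_split; apply: eq_bigr => m _ /=.
by rewrite foldr_linearP scalerDr !scalerA mulrC.
Qed.

Lemma free_actPl c u u' v :
  free_act (c *: u + u') v = c *: free_act u v + free_act u' v.
Proof. exact: linear_ext_linear. Qed.

Lemma free_act0 v : free_act 0 v = 0.
Proof. exact: (raddf0 (linear_ext _)). Qed.

(** Bilinearity reduces to words, where concatenation acts as composition. *)
Lemma free_actM u u' v : free_act (u * u') v = free_act u (free_act u' v).
Proof.
elim/free_alg_ind: u => [|c s u IHu]; first by rewrite mul0r !free_act0.
rewrite mulrDl -scalerAl.
apply: etrans (free_actPl c _ _ _) _.
apply: etrans _ (esym (free_actPl c _ u _)).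
congr (_ *: _ + _); last exact: IHu.
elim/free_alg_ind: u' {u IHu} => [|d t u' IHu].
  rewrite mulr0 free_act0 free_act_fword.
  by elim: s => //= g s <-; rewrite raddf0.
rewrite mulrDr -scalerAr.
apply: etrans (free_actPl d _ _ _) _.
apply: etrans _ (esym (congr1 (free_act _) (free_actPl d _ u' _))).
apply: etrans _ (esym (free_actPr _ d _ _)).
congr (_ *: _ + _); last exact: IHu.
by rewrite fwordM !free_act_fword foldr_cat.
Qed.

End FreeAction.

Section FreeActionQuotient.
Variables (k : comNzRingType) (T : choiceType) (V : lmodType k).
Variables (o : T -> {linear V -> V}) (S : free_alg k T -> Prop).
Hypothesis act_rel : forall r v, S r -> free_act o r v = 0.

Lemma free_act_ideal u v : ideal_gen S u -> free_act o u v = 0.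
Proof.
elim=> [|a r b Sr|w w' _ IHw _ IHw']; first exact: free_act0.
  apply: etrans (free_actM _ _ b v) _.
  apply: etrans (free_actM _ a r _) _.
  apply: etrans (congr1 (free_act o a) (act_rel _ Sr)) _.
  by have := free_actPr o a (-1) 0 0; rewrite scaler0 addr0 scaleN1r addNr.
apply: etrans (raddfD (linear_ext _) w w') _.
by rewrite [X in X + _]IHw [X in _ + X]IHw' addr0.
Qed.

Lemma free_act_quot u v : free_act o (arepr (aclass S u)) v = free_act o u v.
Proof.
apply/subr0_eq; apply: etrans (esym (raddfB (linear_ext _) _ u)) _.
exact: free_act_ideal (areprB S u).
Qed.

End FreeActionQuotient.

(** * The center of [algA] *)

Section CenterAlgA.
Variable k : fieldType.

Local Notation A := (algA k).
Local Notation V := {malg k[seq letter]}.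
Local Notation class := (aclass (@A_rel k)).
Local Notation gen g := (class (free_gen k (letter_ord g))).

Let o (i : 'I_3) : {linear V -> V} := linear_ext (op k (ord_letter i)).

Let act_gen (g : letter) v :
  free_act o (free_gen k (letter_ord g)) v = linear_ext (op k g) v.
Proof. by rewrite free_genE free_act_fword /= letter_ordK. Qed.

Let act_gen2 (g h : letter) v :
  free_act o (free_gen k (letter_ord g) * free_gen k (letter_ord h)) v
    = linear_ext (op k g) (linear_ext (op k h) v).
Proof. by rewrite free_actM !act_gen. Qed.

Let op2 (g h : letter) w :
  linear_ext (op k g) (linear_ext (op k h) << w >>)
    = linear_ext (op k g) (op k h w).
Proof. by rewrite linear_extU scale1r. Qed.

Let op2_eq0 (g h : letter) :
    (forall w, linear_ext (op k g) (op k h w) = 0) ->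
  forall v, linear_ext (op k g) (linear_ext (op k h) v) = 0.
Proof.
move=> gh0; apply: (malg_linear_eq
  (f := [the {linear _ -> _} of linear_ext (op k g) \o linear_ext (op k h)])
  (g := [the {linear _ -> _} of \0])) => w.
by rewrite /= op2.
Qed.

(** Checked on all words, normal or not. The two terms of xx + yx cancel; x kills the words starting
    with z; after y a word starts with y or xx, both killed by z. *)
Let act_rel r v : A_rel r -> free_act o r v = 0.
Proof.
case.
- apply: etrans (raddfD (linear_ext _) _ _) _.
  apply: etrans (congr2 +%R (act_gen2 X X v) (act_gen2 Y X v)) _.
  elim/malg_ind: v => [|c w v IHv]; first by rewrite !raddf0 addr0.
  rewrite !linear_ext_linear addrACA IHv addr0 -scalerDr !op2.
  by case: w => [|[] w];
    rewrite /= ?raddf0 ?addr0 ?linear_extU ?scale1r ?subrr ?scaler0.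
- apply: etrans (act_gen2 X Z v) _; apply: op2_eq0 => w.
  by case: w => [|[] [|[] w]]; rewrite /= ?raddf0 ?linear_extU ?scaler0.
- apply: etrans (act_gen2 Z Y v) _; apply: op2_eq0 => w.
  by case: w => [|[] [|[] w]];
    rewrite /= ?raddfN ?raddf0 /= ?linear_extU ?scaler0 ?oppr0.
Qed.

Let rel0 r : A_rel r -> class r = 0.
Proof.
move=> rel_r; apply: etrans (raddf0 (aclass (@A_rel k))).
apply/aclassP; rewrite subr0 -[r]mulr1 -[r]mul1r.
exact: ideal_genM.
Qed.

Let gen_ind (Q : A -> Prop) :
  Q 1 -> (forall g a, Q a -> Q (gen g * a)) -> Q 0 ->
  (forall c a b, Q a -> Q b -> Q (c *: a + b)) -> forall a, Q a.
Proof.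
move=> Q1 QM Q0 QD a; rewrite -[a]areprK.
elim/free_alg_ind: (arepr a) => [|c s u IHu].
  by rewrite [class 0](raddf0 (aclass (@A_rel k))).
rewrite [class _](aclass_linear (@A_rel k) c (fword k s) u); apply: QD => //.
elim: s => [|i s IHs]; first by rewrite fword0.
rewrite -[i :: s]/([:: i] ++ s) -fwordM -free_genE -(ord_letterK i).
rewrite [class _](rmorphM (aclass (@A_rel k))).
exact: QM.
Qed.

Lemma algA_scalar_center (m : A) :
  (forall a, a * m = m * a) -> exists c : k, m = c%:A.
Proof.
have classM u v : class u * class v = class (u * v).
  exact: esym (rmorphM (aclass (@A_rel k)) u v).
(* A class acts through its chosen representative, which may be replaced by any other. *)
have quotE u v := free_act_quot act_rel u v.
apply: (@scalar_center_of_word_action k A (fun g => gen g) _ _ _ gen_ind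
  (fun q v => free_act o (arepr q) v)).
- apply/eqP; rewrite -addr_eq0 addrC; apply/eqP.
  rewrite !classM; apply: etrans (esym (raddfD (aclass (@A_rel k)) _ _)) _.
  exact: rel0 (A_rel_xx k).
- by rewrite classM; apply: rel0 (A_rel_xz k).
- by rewrite classM; apply: rel0 (A_rel_zy k).
- move=> c a b v.
  have -> : c *: a + b = class (c *: arepr a + arepr b).
    by apply: etrans (esym (aclass_linear _ c _ _)); rewrite /= !areprK.
  apply: etrans (quotE (c *: arepr a + arepr b) v) _.
  exact: free_actPl.
- move=> v; apply: etrans (quotE 1 v) _.
  by rewrite -fword0 free_act_fword.
- move=> g a v; rewrite -{1}[a]areprK classM.
  apply: etrans (quotE (free_gen k (letter_ord g) * arepr a) v) _.
  by rewrite free_actM act_gen.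
Qed.

End CenterAlgA.

Theorem proposition3p5 (k : fieldType) (pchar_k : [pchar k] =i pred0) :
  exists f : {linear k^o -> HH (algA k) 0}, bijective f.
Proof.
apply: HH0_bijective_of_scalar_center => [|c d /eqP].
  exact: algA_scalar_center.
by rewrite -subr_eq0 -scalerBl scaler_eq0 oner_eq0 orbF subr_eq0 => /eqP.
Qed.
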